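(* Let $\alpha \ge 2$ be an integer. Every finite simple graph $G$ with vertex-edge diameter $d_{ve}(G)=3$ and independence number $\alpha(G)=\alpha$ satisfies $P(G)\le 2\alpha+1$, and there exists a graph of diameter $3$ with vertex-edge diameter $3$ and independence number $\alpha$ whose pegging number is exactly $2\alpha+1$; thus the maximum pegging number of such graphs is $2\alpha+1$. Furthermore, if $G$ has $d_{ve}(G)=3$ and $\alpha(G)=\alpha$, then for every distribution of at least $2\alpha+1$ pegs on $G$ and every vertex $t$, a peg can be placed on $t$ using at most $7$ pegging moves.
   Context: All graphs are finite and simple. A graph is non-null if it has at least one edge. The distance between a vertex $x$ and an edge $e$ is the minimum distance from $x$ to an endpoint of $e$; the vertex-edge diameter $d_{ve}(G)$ of a non-null graph $G$ is the maximum distance between a vertex and an edge of $G$. $\alpha(G)$ denotes the independence number. A distribution of pegs on $G$ is a subset $D \subseteq V(G)$. If $u,v \in D$ are distinct adjacent vertices and $w \notin D$ is a vertex adjacent to $v$, the pegging move (jumping $u$ over $v$ into $w$) replaces $D$ by $(D\setminus\{u,v\})\cup\{w\}$. A vertex $t$ is reachable from $D$ if some finite (possibly empty) sequence of pegging moves starting from $D$ ends in a distribution containing $t$; $\mathrm{Reach}(D)$ is the set of reachable vertices. The pegging number $P(G)$ is the smallest positive integer $d$ such that every distribution of size $d$ on $G$ has reach $V(G)$. *)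

(* Defs.v *)
From mathcomp Require Import all_boot.

Set Implicit Arguments.
Unset Strict Implicit.
Unset Printing Implicit Defensive.

Record sgraph := SGraph {
  vertex :> finType;
  adj : rel vertex;
  adj_sym : symmetric adj;
  adj_irr : irreflexive adj }.

Section Graph.
Variable G : sgraph.
Implicit Types (x y u v w t : G) (D S : {set G}).

(* Distances are given as relations: between vertices of different components
   no natural number is the distance, i.e., the distance is infinite. *)
Definition walk (k : nat) x y : Prop :=
  exists p : seq G, [/\ path (@adj G) x p, last x p = y & size p = k].

Definition is_dist x y (k : nat) : Prop :=
  walk k x y /\ forall j, walk j x y -> k <= j.

(* Distance from x to the edge uv; an infinite distance to one endpoint does
   not contribute to the minimum. *)
Definition is_dist_edge x u v (k : nat) : Prop :=
  (is_dist x u k \/ is_dist x v k) /\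
  forall j, is_dist x u j \/ is_dist x v j -> k <= j.

(* Both diameters are maxima; all the distances involved must be finite, so
   a graph with infinite diameter is related to no k. *)
Definition diameter (k : nat) : Prop :=
  (exists x y, is_dist x y k) /\
  forall x y, exists2 j, is_dist x y j & j <= k.

Definition ve_diameter (k : nat) : Prop :=
  (exists x u v, adj u v /\ is_dist_edge x u v k) /\
  forall x u v, adj u v -> exists2 j, is_dist_edge x u v j & j <= k.

Definition independent S : bool :=
  [forall x in S, forall y in S, ~~ adj x y].

Definition independence_number : nat :=
  \max_(S : {set G} | independent S) #|S|.

(* u jumps over v into w; u and v are distinct because adj is irreflexive. *)
Definition peg_move : rel {set G} := fun D D' =>
  [exists u, exists v, exists w,
    [&& u \in D, v \in D, adj u v, w \notin D, adj v w
      & D' == w |: (D :\: [set u; v])]].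

Definition reach D : {set G} :=
  [set t | [exists D', connect peg_move D D' && (t \in D')]].

Definition pegging_bound (d : nat) : bool :=
  (0 < d) && [forall D : {set G}, (#|D| == d) ==> (reach D == [set: G])].

(* No distribution has more than #|G| pegs. *)
Lemma ex_pegging_bound : exists d, pegging_bound d.
Proof.
exists #|G|.+1; apply/andP; split=> //.
apply/forallP=> D; apply/implyP=> /eqP cD.
by have := max_card (mem D); rewrite cD ltnn.
Qed.

Definition pegging_number : nat := ex_minn ex_pegging_bound.

Definition reachable_within (n : nat) D t : Prop :=
  exists s : seq {set G},
    [/\ path peg_move D s, size s <= n & t \in last D s].

End Graph.

Definition is_maximum (A : nat -> Prop) (m : nat) : Prop :=
  A m /\ forall k, A k -> k <= m.

(* Main.v *)
Require Import Defs.
From mathcomp Require Import all_boot zify.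

(** Upper bound.  A pegged edge at distance 3 from [t] yields a peg at distance
    2; a pegged path on four vertices (not necessarily induced) yields a peg on
    a neighbour [w] of [t] in three moves, since the first vertex jumped over
    can be pegged again.  So it suffices to peg some neighbour [w] of [t] by
    three moves and, from the remaining pegs, a neighbour of [w] by three more.
    If the remaining set [S] does not allow the latter ("stuck"), then [S]
    contains no path on four vertices, so its components are stars and
    triangles; trading one vertex of each triangle for a vertex at distance 2
    from [w] produces, together with [w], an independent set which forces
    [#|S| + #triangles <= 2 * alpha - 2].  For a distribution of
    [2 * alpha + 1] pegs this leaves only the case where all pegged edges are at
    distance 3 from [t]; there every four-vertex set that pegs a neighbour of
    [t] leaves exactly one triangle and no isolated peg, and comparing a few
    such four-vertex sets yields seven pegs that suffice.

    Lower bound.  Link [alpha] cliques pairwise by single edges, pairwise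
    disjoint; put four pegs in one clique and two in all the others but one,
    off the links.  Only one clique can ever send a peg elsewhere, and once the
    empty clique has received a peg nothing more can reach it. *)

Set Implicit Arguments.
Unset Strict Implicit.
Unset Printing Implicit Defensive.

(** * Weak moves *)

Section WeakMoves.
Variable G : sgraph.
Implicit Types (x y z u v w t m p q : G) (D E S I J : {set G}).

Lemma adjC x y : adj x y = adj y x. Proof. exact: adj_sym. Qed.

Lemma adj_neq x y : adj x y -> x != y.
Proof. by apply: contraTneq => ->; rewrite adj_irr. Qed.

(* Unlike in [peg_move], the landing vertex may already be pegged, or be one
   of the two pegs removed; this makes solvability monotone in [D]. *)
Fixpoint solvable n D t : bool :=
  (t \in D) ||
  if n is n'.+1 then
    [exists u, exists v, exists w,
      [&& u \in D, v \in D, adj u v, adj v w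
        & solvable n' (w |: D :\: [set z in [:: u; v]]) t]]
  else false.

Arguments solvable : simpl never.

Lemma solvable0 D t : solvable 0 D t = (t \in D). Proof. exact: orbF. Qed.

Lemma solvable_in n D t : t \in D -> solvable n D t.
Proof. by case: n => [|n]; rewrite /solvable => ->. Qed.

Lemma solvable_move u v w n D t :
  u \in D -> v \in D -> adj u v -> adj v w ->
  solvable n (w |: D :\: [set z in [:: u; v]]) t -> solvable n.+1 D t.
Proof.
move=> uD vD uv vw sol; apply/orP; right; apply/existsP; exists u.
by apply/existsP; exists v; apply/existsP; exists w; apply/and5P.
Qed.

Lemma solvableS n D t : solvable n.+1 D t ->
  t \in D \/ exists u v w, [/\ u \in D, v \in D, adj u v, adj v w
    & solvable n (w |: D :\: [set z in [:: u; v]]) t].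
Proof.
case/orP=> [|/existsP[u /existsP[v /existsP[w /and5P[]]]]]; first by left.
by move=> *; right; exists u, v, w.
Qed.

Lemma solvable_sub n D E t : D \subset E -> solvable n D t -> solvable n E t.
Proof.
elim: n D E => [|n IHn] D E /subsetP sDE.
  by rewrite !solvable0; apply: sDE.
case/solvableS=> [/sDE/solvable_in // | [u [v [w [uD vD uv vw]]]] sol].
apply: (@solvable_move u v w); rewrite ?sDE //.
apply: IHn sol; apply/subsetP=> z; rewrite !inE.
by case/orP=> [->//|/andP[-> /sDE->]]; rewrite orbT.
Qed.

Lemma solvable_leq k n D t : k <= n -> solvable k D t -> solvable n D t.
Proof.
elim: k n D => [|k IHk] [|n] D //.
- by rewrite solvable0 => _ /solvable_in.
- move=> lekn /solvableS[/solvable_in // | [u [v [w [uD vD uv vw]]]] sol].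
  by apply: (@solvable_move u v w) => //; apply: IHk.
Qed.

(** The genuine distribution [E] always contains the weak one: a weak move landing in [E] is
    skipped, any other is played as it stands. *)
Lemma solvable_reachable_within n D t : solvable n D t -> reachable_within n D t.
Proof.
suff gen E : D \subset E -> solvable n D t -> reachable_within n E t by exact: gen.
elim: n D E => [|n IHn] D E sDE.
  by rewrite solvable0 => tD; exists [::]; split; rewrite //= (subsetP sDE).
case/solvableS=> [tD | [u [v [w [uD vD uv vw]]]] sol].
  by exists [::]; split; rewrite //= (subsetP sDE).
have [uE vE] := (subsetP sDE _ uD, subsetP sDE _ vD).
case: (boolP (w \in E)) => wE.
  have sub : w |: D :\: [set z in [:: u; v]] \subset E.
    apply/subsetP=> z; rewrite !inE => /orP[/eqP->//|/andP[_ zD]].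
    exact: (subsetP sDE).
  have [s [ps ls ts]] := IHn _ _ sub sol.
  by exists s; split=> //; apply: leqW.
have sub : w |: D :\: [set z in [:: u; v]] \subset w |: E :\: [set u; v].
  apply/subsetP=> z; rewrite !inE; case/orP=> [->//|/andP[-> zD]].
  by rewrite (subsetP sDE) ?orbT.
have [s [ps ls ts]] := IHn _ _ sub sol.
exists ((w |: E :\: [set u; v]) :: s); split=> //=.
rewrite ps andbT; apply/existsP; exists u; apply/existsP; exists v.
by apply/existsP; exists w; rewrite uE vE uv wE vw /=.
Qed.

Lemma reachable_within_reach n D t : reachable_within n D t -> t \in reach D.
Proof.
case=> s [ps _ ts]; rewrite inE; apply/existsP; exists (last D s).
by rewrite ts andbT; apply/connectP; exists s.
Qed.

(** What remains to be done once a peg is kept on [w]: a second peg, on a neighbour of [w], can then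
    jump over it. *)
Definition near n S w := [exists m, adj m w && solvable n S m].

Lemma near_leq k n S w : k <= n -> near k S w -> near n S w.
Proof.
move=> lekn /existsP[x /andP[xw /(solvable_leq lekn) sol]].
by apply/existsP; exists x; rewrite xw.
Qed.

(* If a peg of [S] ever lands on [w], the jumped peg is already adjacent to
   [w]; so the peg kept on [w] cannot get in the way. *)
Lemma solvable_guard n S w t :
  w \notin S -> adj w t -> near n S w -> solvable n.+1 (w |: S) t.
Proof.
move=> wS wt /existsP[m /andP[mw]].
have jump z S' k : adj z w -> z \in S' -> solvable k.+1 (w |: S') t.
  move=> zw zS; apply: (@solvable_move z w t) => //; rewrite ?inE ?zS ?eqxx ?orbT //.
  by apply: solvable_in; rewrite !inE eqxx.
elim: n S wS => [|n IHn] S wS.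
  by rewrite solvable0 => mS; apply: jump mw mS.
case/solvableS=> [mS | [u [v [z [uS vS uv vz]]]] sol]; first exact: jump mw mS.
have [zw|zw] := eqVneq z w; first by apply: jump vS; rewrite -zw.
apply: (@solvable_move u v z); rewrite ?inE ?uS ?vS ?orbT //.
have wS' : w \notin z |: S :\: [set z in [:: u; v]].
  by rewrite !inE negb_or eq_sym zw (negPf wS) andbF.
apply: solvable_sub (IHn _ wS' sol); apply/subsetP=> y; rewrite !inE.
case/orP=> [/eqP->|/orP[->//|/andP[-> ->]]]; last by rewrite !orbT.
rewrite eqxx /= andbT; apply/orP; right; rewrite negb_or.
by apply/andP; split; apply: contraNneq wS => ->.
Qed.

Lemma near_mem n S w x : x \in S -> adj x w -> near n S w.
Proof. by move=> xS xw; apply/existsP; exists x; rewrite xw solvable_in. Qed.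

Lemma near_edge S w x y m :
  x \in S -> y \in S -> adj x y -> adj y m -> adj m w -> near 1 S w.
Proof.
move=> xS yS xy ym mw; apply/existsP; exists m; rewrite mw.
by apply: (@solvable_move x y m) => //; rewrite solvable_in // !inE eqxx.
Qed.

Lemma mem_rest D p u v r : r \in D -> r != u -> r != v ->
  r \in p |: D :\: [set z in [:: u; v]].
Proof. by move=> rD ru rv; rewrite !inE negb_or ru rv rD orbT. Qed.

(** [x] jumps over [y] into [p], then [z] over [p] into [m]. As [p] starts empty, emptying it again
    costs no peg of [D]. *)
Lemma solvable_cherry n D x y z p m t :
  x \in D -> y \in D -> z \in D -> z \notin [:: x; y] -> adj x y -> adj y p ->
  adj z p -> adj p m -> p \notin D ->
  solvable n (m |: D :\: [set s in [:: x; y; z]]) t -> solvable n.+2 D t.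
Proof.
rewrite !inE !negb_or => xD yD zD /andP[zx zy] xy yp zp pm pD sol.
apply: (@solvable_move x y p) => //.
apply: (@solvable_move z p m); rewrite ?setU11 ?mem_rest //.
apply: solvable_sub sol; apply/subsetP=> s; rewrite !inE !negb_or.
case: eqP => //= _; case/andP=> /and3P[-> -> ->] sD; rewrite sD orbT !andbT.
by apply: contraNneq pD => <-.
Qed.

(** [x] jumps over [y] into [p], [s] over [z] back into the vacated [y], and [y] over [p] into
    [m]. *)
Lemma solvable_path4 n D x y z s p m t :
  x \in D -> y \in D -> z \in D -> s \in D -> uniq [:: x; y; z; s] ->
  adj x y -> adj y z -> adj z s -> adj y p -> adj p m -> p \notin D ->
  solvable n (m |: D :\: [set r in [:: x; y; z; s]]) t -> solvable n.+3 D t.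
Proof.
rewrite /= !inE !negb_or => xD yD zD sD.
case/and4P=> /and3P[xy xz xs] /andP[yz ys] zs _ axy ayz azs ayp apm pD sol.
apply: (@solvable_move x y p) => //.
have [azy asz] : adj z y /\ adj s z by rewrite (adjC s) (adjC z).
apply: (@solvable_move s z y) => //;
  try by apply: mem_rest; rewrite // eq_sym.
apply: (@solvable_move y p m); rewrite ?setU11 //.
  by apply: mem_rest; rewrite ?setU11 //; apply: contraNneq pD => ->.
apply: solvable_sub sol; apply/subsetP=> r; rewrite !inE !negb_or.
case: eqP => //= _; case/andP=> /and4P[-> -> -> ->] rD; rewrite rD !orbT !andbT.
by apply: contraNneq pD => <-.
Qed.

(** [y] jumps over [x] into [p], [s] over [z] into [q], and [p] over [q] into [m]. *)
Lemma solvable_two_edges n D x y z s p q m t :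
  x \in D -> y \in D -> z \in D -> s \in D -> uniq [:: x; y; z; s] ->
  adj x y -> adj z s -> adj x p -> adj z q -> adj p q -> adj q m ->
  p \notin D -> q \notin D ->
  solvable n (m |: D :\: [set r in [:: x; y; z; s]]) t -> solvable n.+3 D t.
Proof.
rewrite /= !inE !negb_or => xD yD zD sD.
case/and4P=> /and3P[xy xz xs] /andP[yz ys] zs _ axy azs axp azq apq aqm pD qD sol.
have [ayx asz] : adj y x /\ adj s z by rewrite !(adjC _ x) !(adjC _ z).
apply: (@solvable_move y x p) => //.
apply: (@solvable_move s z q) => //;
  try by apply: mem_rest; rewrite // eq_sym.
apply: (@solvable_move p q m); rewrite ?setU11 //.
  by apply: mem_rest; rewrite ?setU11 //; apply: contraNneq pD => ->.
apply: solvable_sub sol; apply/subsetP=> r; rewrite !inE !negb_or.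
case: eqP => //= _; case/andP=> /and4P[-> -> -> ->] rD; rewrite rD !orbT !andbT.
by apply/andP; split; [apply: contraNneq pD => <-|apply: contraNneq qD => <-].
Qed.

Lemma near_cherry S w x y z p m :
  x \in S -> y \in S -> z \in S -> z \notin [:: x; y] -> adj x y -> adj y p ->
  adj z p -> adj p m -> p \notin S -> adj m w -> near 2 S w.
Proof.
move=> xS yS zS zxy xy yp zp pm pS mw; apply/existsP; exists m; rewrite mw /=.
apply: (solvable_cherry xS yS zS zxy xy yp zp pm pS).
by rewrite solvable_in // !inE eqxx.
Qed.

Lemma near_path4 S w x y z s p m :
  x \in S -> y \in S -> z \in S -> s \in S -> uniq [:: x; y; z; s] ->
  adj x y -> adj y z -> adj z s -> adj y p -> adj p m -> p \notin S ->
  adj m w -> near 3 S w.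
Proof.
move=> xS yS zS sS U xy yz zs yp pm pS mw; apply/existsP; exists m; rewrite mw.
apply: (solvable_path4 xS yS zS sS U xy yz zs yp pm pS).
by rewrite solvable_in // !inE eqxx.
Qed.

Lemma near_two_edges S w x y z s p q m :
  x \in S -> y \in S -> z \in S -> s \in S -> uniq [:: x; y; z; s] ->
  adj x y -> adj z s -> adj x p -> adj z q -> adj p q -> adj q m ->
  p \notin S -> q \notin S -> adj m w -> near 3 S w.
Proof.
move=> xS yS zS sS U xy zs xp zq pq qm pS qS mw; apply/existsP; exists m.
rewrite mw; apply: (solvable_two_edges xS yS zS sS U xy zs xp zq pq qm pS qS).
by rewrite solvable_in // !inE eqxx.
Qed.

End WeakMoves.

(** * Graphs without paths on four vertices *)

Section Path4Free.
Variable G : sgraph.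
Implicit Types (a b c x y z p : G) (S A I J : {set G}).

Definition path4_free S := forall x y z s,
  x \in S -> y \in S -> z \in S -> s \in S -> uniq [:: x; y; z; s] ->
  adj x y -> adj y z -> adj z s -> False.

Definition triangle S a b c :=
  [/\ a \in S, b \in S, c \in S & [/\ adj a b, adj b c & adj a c]].

Definition triangle_free S := forall a b c, ~ triangle S a b c.

Lemma triangle_dec S : triangle_free S \/ exists a b c, triangle S a b c.
Proof.
case: (boolP [exists a, exists b, exists c, [&& a \in S, b \in S, c \in S,
    adj a b, adj b c & adj a c]]).
  case/existsP=> a /existsP[b /existsP[c /and4P[aS bS cS /and3P[ab bc ac]]]].
  by right; exists a, b, c.
move=> ntri; left=> a b c [aS bS cS [ab bc ac]]; case/existsP: ntri; exists a.
by apply/existsP; exists b; apply/existsP; exists c; rewrite aS bS cS ab bc ac.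
Qed.

Lemma triangle_rot S a b c : triangle S a b c -> triangle S b c a.
Proof. by case=> aS bS cS [ab bc ac]; split=> //; split=> //; rewrite adjC. Qed.

Lemma triangle_flip S a b c : triangle S a b c -> triangle S a c b.
Proof. by case=> aS bS cS [ab bc ac]; split=> //; split=> //; rewrite adjC. Qed.

Lemma triangle_uniq S a b c : triangle S a b c -> uniq [:: a; b; c].
Proof.
case=> _ _ _ [ab bc ac].
by rewrite /= !inE (negPf (adj_neq ab)) (negPf (adj_neq ac)) (adj_neq bc).
Qed.

Lemma triangle_adj S a b c x y : triangle S a b c ->
  x \in [:: a; b; c] -> y \in [:: a; b; c] -> x != y -> adj x y.
Proof.
case=> _ _ _ [ab bc ac]; rewrite !inE.
by move=> /or3P[] /eqP-> /or3P[] /eqP->; rewrite ?eqxx // 1?adjC.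
Qed.

Lemma triangle_sub S S' a b c : S \subset S' -> triangle S a b c -> triangle S' a b c.
Proof. by move=> /subsetP sub [aS bS cS adjs]; split=> //; apply: sub. Qed.

Lemma path4_free_sub S S' : S \subset S' -> path4_free S' -> path4_free S.
Proof. by move=> /subsetP sub p4 x y z s /sub ? /sub ? /sub ? /sub ?; apply: p4. Qed.

Lemma triangle_free_sub S S' : S \subset S' -> triangle_free S' -> triangle_free S.
Proof. by move=> sub tf a b c /(triangle_sub sub)/tf. Qed.

(** A neighbour outside the triangle would extend it to a path on four vertices; so triangles are
    whole components. *)
Lemma triangle_closed S a b c x z : path4_free S -> triangle S a b c ->
  x \in [:: a; b; c] -> z \in S -> adj x z -> z \in [:: a; b; c].
Proof.
move=> p4 T.
have gen a' b' c' : triangle S a' b' c' -> z \in S -> adj a' z -> z \in [:: a'; b'; c'].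
  move=> T' zS a'z; apply/negP=> /negP; rewrite !inE !negb_or => /and3P[za zb zc].
  have := triangle_uniq T'; rewrite /= !inE !negb_or => /and3P[/andP[nab nac] nbc _].
  case: T' => aS bS cS [ab bc ac]; apply: (p4 z a' b' c') => //; last by rewrite adjC.
  by rewrite /= !inE !negb_or za zb zc nab nac nbc.
rewrite !inE => /or3P[] /eqP-> zS az.
- by have := gen _ _ _ T zS az; rewrite !inE.
- have := gen _ _ _ (triangle_rot T) zS az; rewrite !inE.
  by case/or3P=> ->; rewrite ?orbT.
- have := gen _ _ _ (triangle_rot (triangle_rot T)) zS az; rewrite !inE.
  by case/or3P=> ->; rewrite ?orbT.
Qed.

Lemma independentP I :
  reflect {in I &, forall x y, ~~ adj x y} (independent I).
Proof.
apply: (iffP forall_inP) => [ind x y xI yI | ind x xI].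
  by have /forall_inP := ind x xI; apply.
by apply/forall_inP=> y; apply: ind.
Qed.

Lemma independentU1 x I :
  independent I -> (forall y, y \in I -> ~~ adj x y) -> independent (x |: I).
Proof.
move=> /independentP ind xI; apply/independentP=> y z; rewrite !inE.
case/orP=> [/eqP->|yI]; case/orP=> [/eqP->|zI]; rewrite ?adj_irr ?xI //.
- by rewrite adjC xI.
- exact: ind.
Qed.

Lemma independent0 : independent (@set0 G).
Proof. by apply/independentP=> x y; rewrite inE. Qed.

(** Following edges from [x0] without turning back, the third step closes a triangle or completes a
    path on four vertices. *)
Lemma low_degree_vertex S : path4_free S -> triangle_free S -> S != set0 ->
  exists x, x \in S /\ exists y, forall z, z \in S -> adj x z -> z = y.
Proof.
move=> p4 tf /set0Pn[x0 x0S].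
have step x y : x \in S ->
    (exists z, [/\ z \in S, adj x z & z != y]) \/
    forall z, z \in S -> adj x z -> z = y.
  move=> xS; case: (boolP [exists z, [&& z \in S, adj x z & z != y]]).
    by case/existsP=> z /and3P[]; left; exists z.
  move/existsP=> none; right=> z zS xz; apply/eqP; apply/negP=> /negP zy.
  by apply: none; exists z; rewrite zS xz.
(* The start has no predecessor; [x0] itself serves, not being its own neighbour. *)
case: (step x0 x0 x0S) => [[x1 [x1S a01 n10]]|]; last by exists x0; split=> //; exists x0.
case: (step x1 x0 x1S) => [[x2 [x2S a12 n20]]|]; last by exists x1; split=> //; exists x0.
case: (step x2 x1 x2S) => [[x3 [x3S a23 n31]]|]; last by exists x2; split=> //; exists x1.
have [e30|n30] := eqVneq x3 x0.
  case: (tf x0 x1 x2); split=> //; split=> //.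
  by rewrite adjC -e30.
case: (p4 x0 x1 x2 x3) => //; rewrite /= !inE !negb_or.
by rewrite (eq_sym x0) n10 (eq_sym x0) n20 (eq_sym x0) n30 (adj_neq a12) (eq_sym x1) n31 (adj_neq a23).
Qed.

(** Choosing a vertex of degree at most one and discarding its possible neighbour uses up at most
    two vertices per chosen one. *)
Lemma half_independent S : path4_free S -> triangle_free S ->
  exists I, [/\ I \subset S, independent I & #|S| <= 2 * #|I|].
Proof.
have [n] := ubnP #|S|; elim: n S => // n IHn S ltSn p4 tf.
have [->|S0] := eqVneq S set0.
  by exists set0; rewrite sub0set independent0 cards0.
have [x [xS [y xy]]] := low_degree_vertex p4 tf S0.
pose S' := S :\: [set x; y].
have sub : S' \subset S by apply: subsetDl.
have cS' : #|S| <= #|S'| + 2.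
  rewrite -(cardsID [set x; y] S) addnC leq_add2l.
  by rewrite (leq_trans (subset_leq_card (subsetIr _ _))) // cards2; case: (_ == _).
have ltS' : #|S'| < n.
  have : #|S'| < #|S|; last lia.
  by apply: proper_card; rewrite properE sub; apply/subsetPn; exists x; rewrite ?inE ?eqxx.
have [I [IS indI cI]] := IHn S' ltS' (path4_free_sub sub p4) (triangle_free_sub sub tf).
have xI : x \notin I by apply/negP=> /(subsetP IS); rewrite !inE eqxx.
exists (x |: I); split.
- by rewrite subUset sub1set xS (subset_trans IS).
- apply: independentU1 => // z zI; apply/negP=> xz.
  have := subsetP IS _ zI; rewrite !inE negb_or => /andP[/andP[_ zy] zS].
  by rewrite (xy z zS xz) eqxx in zy.
- by rewrite cardsU1 xI; lia.
Qed.

(* One vertex [a] is removed from each triangle and traded for a vertex [p]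
   outside of [S] whose only neighbour in [S] is [a]. *)
Lemma triangle_trade (P : pred G) S : path4_free S ->
  (forall a b, a \in S -> b \in S -> adj a b ->
     exists2 p, P p & adj p a \/ adj p b) ->
  (forall a b c p, triangle S a b c -> P p -> adj p a ->
     p \notin S /\ forall z, z \in S -> adj p z -> z = a) ->
  (forall a b c a' b' p p', triangle S a b c ->
     a' \in S -> b' \in S -> adj a' b' -> uniq [:: a; b; a'; b'] ->
     c != a' -> c != b' ->
     P p -> adj p a -> P p' -> adj p' a' -> ~~ adj p p') ->
  exists A J, [/\ A \subset S, triangle_free (S :\: A), independent J,
    #|J| = #|A| &
    forall p, p \in J -> [/\ P p, p \notin S & forall z, z \in S -> adj p z -> z \in A]].
Proof.
move=> p4 HP Hpriv Hnadj.
(* The induction shrinks [S'], while privacy of the traded vertices stays relative to the full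
   [S]. *)
suff gen S' : S' \subset S -> exists A J, [/\ A \subset S', triangle_free (S' :\: A),
    independent J, #|J| = #|A| &
    forall p, p \in J -> P p /\ exists a b,
      [/\ a \in A, b \in S', adj a b, adj p a
        & p \notin S /\ forall z, z \in S -> adj p z -> z = a]].
  have [A [J [AS tf indJ cJ HJ]]] := gen S (subxx _).
  exists A, J; split=> // p /HJ [Pp [a [b [aA bS ab pa [pS priv]]]]].
  by split=> // z zS /(priv z zS)->.
have [n] := ubnP #|S'|; elim: n S' => // n IHn S' ltSn sub.
case: (triangle_dec S') => [tf|[a0 [b0 [c0 T0]]]].
  exists set0, set0; split; rewrite ?sub0set ?independent0 ?setD0 //.
  by move=> p; rewrite inE.
have [a [b [c [p [T Pp pa]]]]] :
    exists a b c p, [/\ triangle S' a b c, P p & adj p a].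
  have [aS bS cS [ab bc ac]] := triangle_sub sub T0.
  have [p Pp [pa|pb]] := HP a0 b0 aS bS ab; first by exists a0, b0, c0, p.
  by exists b0, c0, a0, p; split=> //; apply: triangle_rot.
have T1 := triangle_sub sub T.
have p4' := path4_free_sub sub p4.
have [aS' bS' cS' [ab bc ac]] := T.
(* Deleting the whole triangle, not only [a], keeps later edges [a' b'] disjoint from it, as [Hnadj]
   requires. *)
pose S2 := S' :\: [set z in [:: a; b; c]].
have sub2 : S2 \subset S' by apply: subsetDl.
have lt2 : #|S2| < n.
  have : #|S2| < #|S'|; last lia.
  apply: proper_card; rewrite properE sub2; apply/subsetPn; exists a => //.
  by rewrite !inE eqxx.
have [A [J [AS tf indJ cJ HJ]]] := IHn S2 lt2 (subset_trans sub2 sub).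
have [pS priv] := Hpriv a b c p T1 Pp pa.
have aA : a \notin A by apply/negP=> /(subsetP AS); rewrite !inE eqxx.
have pJ : p \notin J.
  apply/negP=> /HJ [_ [a' [b' [a'A _ _ pa' _]]]].
  have a'S : a' \in S by apply: (subsetP sub); apply: (subsetP sub2); apply: (subsetP AS).
  by rewrite -(priv a' a'S pa') a'A in aA.
exists (a |: A), (p |: J); split.
- by rewrite subUset sub1set aS' (subset_trans AS).
- move=> x y z Txyz.
  have sub' : S' :\: (a |: A) \subset S' by apply: subsetDl.
  have T2 := triangle_sub sub' Txyz.
  (* A triangle avoiding [a] avoids [b] and [c] too, since otherwise [triangle_closed] would put [a]
     in it. *)
  have out r : r \in [:: x; y; z] -> r \in S2 :\: A.
    move=> rT; have rS : r \in S' :\: (a |: A).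
      by case: Txyz => xS yS zS _; move: rT; rewrite !inE => /or3P[] /eqP->;
         move: xS yS zS; rewrite !inE.
    move: (rS); rewrite !inE !negb_or => /andP[/andP[ra rA] rS'].
    rewrite rA rS' ra andbT /=; apply: contraT => rbc.
    have : a \in [:: x; y; z].
      have [/andP[ra' aT]|] := boolP ((r != a) && (r \in [:: a; b; c])).
        apply: (triangle_closed p4' T2 rT aS').
        by apply: (triangle_adj T) => //; rewrite inE eqxx.
      by rewrite ra !inE (negPf ra) /=; move: rbc; rewrite negb_and !negbK => ->.
    rewrite !inE => /or3P[] /eqP e; case: Txyz => xS yS zS _; move: xS yS zS;
      by rewrite -e !inE eqxx.
  by apply: (tf x y z); case: Txyz => _ _ _ adjs; split=> //; apply: out; rewrite !inE eqxx ?orbT.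
- apply: independentU1 => // p' p'J; have [Pp' [a' [b' [a'A b'S a'b' p'a' _]]]] := HJ _ p'J.
  have a'S : a' \in S2 by apply: (subsetP AS).
  have s2 := subset_trans sub2 sub.
  have s2' := subsetP s2.
  apply: (Hnadj a b c a' b') => //; try exact: s2'.
  + move: a'S b'S; rewrite !inE !negb_or => /andP[/and3P[? ? ?] _] /andP[/and3P[? ? ?] _].
    rewrite /= !inE !negb_or (adj_neq ab) (adj_neq a'b') !(eq_sym a) !(eq_sym b).
    by do ?[apply/andP; split].
  + by move: a'S; rewrite !inE !negb_or [c == _]eq_sym => /andP[/and3P[]].
  + by move: b'S; rewrite [c == _]eq_sym !inE !negb_or => /andP[/and3P[]].
- by rewrite !cardsU1 pJ aA cJ.
- move=> p'; rewrite !inE => /orP[/eqP->|/HJ [Pp' [a' [b' [a'A b'S a'b' p'a' priv']]]]].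
    by split=> //; exists a, b; rewrite !inE eqxx.
  split=> //; exists a', b'; split=> //; first by rewrite !inE a'A orbT.
  exact: (subsetP sub2).
Qed.

End Path4Free.

(** * The upper bound *)

Section UpperBound.
Variables (G : sgraph) (alpha : nat).
Implicit Types (a b c x y z u v w t m p q : G) (D S I J A Q : {set G}).

(** Only a walk of length two: [p] may equal [w] or be adjacent to it, which is excluded where it
    matters. *)
Definition gate w p := [exists m, adj w m && adj m p].

Hypothesis ve3 : forall x u v, adj u v -> exists2 y, y \in [:: u; v] &
  [\/ x = y, adj x y, gate x y | exists2 p, gate x p & adj p y].
Hypothesis indep_le : forall I, independent I -> #|I| <= alpha.

Lemma gateP w p : reflect (exists2 m, adj w m & adj m p) (gate w p).
Proof.
apply: (iffP existsP) => [[m /andP[]]|[m wm mp]]; first by exists m.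
by exists m; rewrite wm.
Qed.

(** The vertex [w], the [#|A|] traded vertices and at least half of [S :\: A] are independent
    together, so [1 + #|A| + (#|S| - #|A|) / 2 <= alpha]. *)
Lemma trade_bound w S : w \notin S -> (forall x, x \in S -> ~~ adj w x) ->
  path4_free S ->
  (forall x y, x \in S -> y \in S -> adj x y ->
     exists2 p, gate w p & adj p x \/ adj p y) ->
  (forall p x y, gate w p -> adj p x -> x \in S -> y \in S -> adj x y ->
     [/\ p \notin S, p != w & ~~ adj w p]) ->
  (forall a b c p z, triangle S a b c -> gate w p -> adj p a -> z \in S ->
     adj p z -> z = a) ->
  (forall a b c a' b' p p', triangle S a b c ->
     a' \in S -> b' \in S -> adj a' b' -> uniq [:: a; b; a'; b'] ->
     c != a' -> c != b' ->
     gate w p -> adj p a -> gate w p' -> adj p' a' -> ~~ adj p p') ->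
  exists A, [/\ A \subset S, triangle_free (S :\: A)
    & #|S| + #|A| + 2 <= 2 * alpha].
Proof.
move=> wS wadj p4 edge out nbr nadj.
pose P p := [&& gate w p, p != w & ~~ adj w p].
have [] := @triangle_trade G P S p4.
- move=> x y xS yS xy; have yx : adj y x by rewrite adjC.
  have [p wp pxy] := edge x y xS yS xy; exists p => //; rewrite /P wp /=.
  by case: pxy => pz; [have [_ -> ->] := out p x y wp pz xS yS xy
                      |have [_ -> ->] := out p y x wp pz yS xS yx].
- move=> a b c p T /andP[wp _] pa; have [aS bS cS [ab bc ac]] := T.
  have [pS _ _] := out _ _ _ wp pa aS bS ab; split=> // z.
  exact: (nbr a b c p).
- move=> a b c a' b' p p' T a'S b'S a'b' U ca cb /andP[wp _] pa /andP[wp' _] p'a'.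
  exact: (nadj a b c a' b').
move=> A [J [AS tf indJ cJ HJ]].
have sub : S :\: A \subset S by apply: subsetDl.
have [I [IS indI cI]] := half_independent (path4_free_sub sub p4) tf.
have JS p : p \in J -> p \notin S by case/HJ.
have disj : [disjoint J & I].
  rewrite disjoint_subset; apply/subsetP=> p /JS pS; rewrite inE.
  by apply: contra pS => /(subsetP IS); rewrite inE => /andP[].
have wJ p : p \in J -> p != w /\ ~~ adj w p.
  by case/HJ=> /and3P[].
have ind : independent (w |: (J :|: I)).
  apply: independentU1.
    apply/independentP=> x y; rewrite !inE.
    have JI p z : p \in J -> z \in I -> ~~ adj p z.
      move=> /HJ[_ _ priv] /(subsetP IS); rewrite inE => /andP[zA zS].
      by apply: contra zA; apply: priv.
    case/orP=> [xJ|xI]; case/orP=> [yJ|yI].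
    + exact: (elimT (independentP _) indJ).
    + exact: JI.
    + by rewrite adjC JI.
    + exact: (elimT (independentP _) indI).
  move=> y; rewrite inE => /orP[/wJ[]// | yI].
  by apply: wadj; apply: (subsetP sub); apply: (subsetP IS).
exists A; split=> //.
have := indep_le ind; rewrite cardsU1 inE negb_or.
have -> : w \notin J by apply/negP=> /wJ[]; rewrite eqxx.
have -> : w \notin I by apply: contra wS => /(subsetP IS); rewrite inE => /andP[].
rewrite cardsU (disjoint_setI0 disj) cards0 cJ.
have := cardsID A S; rewrite (setIidPr AS); move: cI; clear; lia.
Qed.

(** * Sets of pegs that cannot bring a peg next to [w] *)

Section Stuck.
Variables (w : G) (S : {set G}).
Hypotheses (wS : w \notin S) (stuck : ~~ near 3 S w).

Lemma stuck_nadj x : x \in S -> ~~ adj w x.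
Proof. by move=> xS; apply: contra stuck => wx; apply: near_mem xS _; rewrite adjC. Qed.

Lemma stuck_ngate x y : x \in S -> y \in S -> adj x y -> ~~ gate w y.
Proof.
move=> xS yS xy; apply: contra stuck => /gateP[m wm my].
by apply: (near_leq (k := 1)) => //; apply: (@near_edge G S w x y m); rewrite // adjC.
Qed.

(** A closer endpoint would be [w] itself or let a neighbour of [w] be pegged in at most one jump,
    so [ve3] leaves only its last case. *)
Lemma stuck_edge x y : x \in S -> y \in S -> adj x y ->
  exists2 p, gate w p & adj p x \/ adj p y.
Proof.
move=> xS yS xy; have yx : adj y x by rewrite adjC.
have [z + dz] := ve3 w xy; rewrite !inE => zxy.
have [zS [s sS sz]] : z \in S /\ exists2 s, s \in S & adj s z.
  by case/orP: zxy => /eqP->; split=> //; [exists y|exists x].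
case: dz => [wz|wz|wz|[p wp pz]].
- by case/negP: wS; rewrite wz.
- by rewrite (negPf (stuck_nadj zS)) in wz.
- by rewrite (negPf (stuck_ngate sS zS sz)) in wz.
- by exists p => //; case/orP: zxy => /eqP <-; [left|right].
Qed.

Lemma stuck_gate_out p x y : gate w p -> adj p x -> x \in S -> y \in S ->
  adj x y -> [/\ p \notin S, p != w & ~~ adj w p].
Proof.
move=> wp px xS yS xy; split.
- by apply: contraL wp => pS; apply: stuck_ngate xS pS _; rewrite adjC.
- by apply: contraTneq px => ->; apply: stuck_nadj.
- have yx : adj y x by rewrite adjC.
  by apply: contra (stuck_ngate yS xS yx) => wp'; apply/gateP; exists p.
Qed.

(** By [stuck_edge] one of the two inner vertices is adjacent to some [p] with [gate w p], and
    [near_path4] applies through [p]. *)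
Lemma stuck_path4_free : path4_free S.
Proof.
have gen x y z s : x \in S -> y \in S -> z \in S -> s \in S ->
    uniq [:: x; y; z; s] -> adj x y -> adj y z -> adj z s ->
    (exists2 p, gate w p & adj p y) -> False.
  move=> xS yS zS sS U xy yz zs [p wp py].
  have [pS _ _] := stuck_gate_out wp py yS zS yz.
  have /gateP[m wm mp] := wp.
  case/negP: stuck; apply: (@near_path4 G S w x y z s p m); rewrite // adjC //.
move=> x y z s xS yS zS sS U xy yz zs.
have [p wp [py|pz]] := stuck_edge yS zS yz.
  by apply: (gen x y z s) => //; exists p.
apply: (gen s z y x); rewrite // 1?adjC //; last by exists p.
by rewrite -[_ :: _]/(rev [:: x; y; z; s]) rev_uniq.
Qed.

(** If [z] were another vertex, one of [b] and [c] differs from it and jumps over [a] into [p],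
    after which [z] jumps over [p]. *)
Lemma stuck_private a b c p z : a \in S -> b \in S -> c \in S -> b != c ->
  adj a b -> adj a c -> gate w p -> adj p a -> z \in S -> adj p z -> z = a.
Proof.
move=> aS bS cS bc ab ac wp pa zS pz; apply/eqP; apply/negP=> /negP za.
have [pS _ _] := stuck_gate_out wp pa aS bS ab; have /gateP[m wm mp] := wp.
have gen d : d \in S -> adj a d -> z != d -> False.
  move=> dS ad zd; case/negP: stuck.
  apply: (near_leq (k := 2)) => //.
  apply: (@near_cherry G S w d a z p m) => //; rewrite ?inE ?negb_or ?za ?zd //;
    by rewrite adjC.
have [zb|] := eqVneq z b; last exact: gen.
by apply: (gen c); rewrite // zb.
Qed.

Lemma stuck_gates_nadj a b a' b' p p' : a \in S -> b \in S -> a' \in S ->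
  b' \in S -> uniq [:: a; b; a'; b'] -> adj a b -> adj a' b' ->
  gate w p -> adj p a -> gate w p' -> adj p' a' -> ~~ adj p p'.
Proof.
move=> aS bS a'S b'S U ab a'b' wp pa wp' p'a'; apply: contra stuck => pp'.
have [pS _ _] := stuck_gate_out wp pa aS bS ab.
have [p'S _ _] := stuck_gate_out wp' p'a' a'S b'S a'b'.
have /gateP[m wm mp] := wp'.
by apply: (@near_two_edges G S w a b a' b' p p' m) => //; rewrite adjC.
Qed.

Lemma stuck_bound : exists A,
  [/\ A \subset S, triangle_free (S :\: A) & #|S| + #|A| + 2 <= 2 * alpha].
Proof.
apply: (trade_bound wS stuck_nadj stuck_path4_free stuck_edge stuck_gate_out).
- move=> a b c p z [aS bS cS [ab bc ac]]; apply: (@stuck_private a b c) => //.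
  exact: adj_neq.
- move=> a b c a' b' p p' [aS bS _ [ab _ _]] a'S b'S a'b' U _ _.
  exact: (stuck_gates_nadj aS bS a'S b'S U ab a'b').
Qed.

End Stuck.

(** * A putative counterexample with [2 * alpha + 1] pegs *)

Section Unsolvable.
Variables (t : G) (D : {set G}).
Hypotheses (cardD : #|D| = 2 * alpha + 1) (unsol : ~~ solvable 7 D t).

Lemma card_rest (s : seq G) : uniq s -> {subset s <= D} ->
  #|D :\: [set z in s]| + size s = 2 * alpha + 1.
Proof.
move=> U sD; rewrite -cardD -(cardsID [set z in s] D) addnC; congr (_ + _).
have -> : D :&: [set z in s] = [set z in s].
  by apply/setIidPr; apply/subsetP=> z; rewrite inE; apply: sD.
by rewrite cardsE; apply/esym/card_uniqP.
Qed.

Lemma unsol_leq n : n <= 7 -> ~~ solvable n D t.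
Proof. by move=> n7; apply: contra unsol; apply: solvable_leq. Qed.

Lemma t_notin : t \notin D.
Proof. by apply: contra unsol; apply: solvable_in. Qed.

(** A pegged neighbour of [t] could be kept as guard, and the other [2 * alpha] pegs are too many to
    be stuck. *)
Lemma nadj_t x : x \in D -> ~~ adj t x.
Proof.
move=> xD; apply/negP=> tx; have xt : adj x t by rewrite adjC.
have xS : x \notin D :\: [set z in [:: x]] by rewrite !inE eqxx.
have cS : #|D :\: [set z in [:: x]]| + 1 = 2 * alpha + 1.
  by apply: (@card_rest [:: x]) => // z; rewrite inE => /eqP->.
case: (boolP (near 3 (D :\: [set z in [:: x]]) x)) => [nr|st].
  case/negP: (@unsol_leq 4 isT); apply: solvable_sub (solvable_guard xS xt nr).
  by apply/subsetP=> z; rewrite !inE => /orP[/eqP->//|/andP[]].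
by have [A [_ _]] := stuck_bound xS st; move: cS; clear; lia.
Qed.

(** One jump would peg a neighbour [w] of [t] and leave [2 * alpha - 1] pegs, one more than a stuck
    set can have. *)
Lemma edge_ngate u v : u \in D -> v \in D -> adj u v -> ~~ gate t v.
Proof.
move=> uD vD uv; apply/negP=> /gateP[w tw wv].
pose S := D :\: [set z in [:: u; v]].
have wS : w \notin S by apply: contraL tw; rewrite inE => /andP[_ /nadj_t].
have cS : #|S| + 2 = 2 * alpha + 1.
  apply: (@card_rest [:: u; v]); first by rewrite /= inE adj_neq.
  by move=> z; rewrite !inE => /orP[] /eqP->.
case: (boolP (near 3 S w)) => [nr|st].
  case/negP: (@unsol_leq 5 isT); apply: (@solvable_move G u v w) => //.
    by rewrite adjC.
  by apply: solvable_guard; rewrite // adjC.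
by have [A [_ _]] := stuck_bound wS st; move: cS; clear; lia.
Qed.

Lemma edge_gate x y : x \in D -> y \in D -> adj x y ->
  exists2 p, gate t p & adj p x \/ adj p y.
Proof.
move=> xS yS xy; have yx : adj y x by rewrite adjC.
have [z + dz] := ve3 t xy; rewrite !inE => zxy.
have [zS [s sS sz]] : z \in D /\ exists2 s, s \in D & adj s z.
  by case/orP: zxy => /eqP->; split=> //; [exists y|exists x].
case: dz => [tz|tz|tz|[p tp pz]].
- by case/negP: t_notin; rewrite tz.
- by rewrite (negPf (nadj_t zS)) in tz.
- by rewrite (negPf (edge_ngate sS zS sz)) in tz.
- by exists p => //; case/orP: zxy => /eqP <-; [left|right].
Qed.

Lemma gate_out p x y : gate t p -> adj p x -> x \in D -> y \in D ->
  adj x y -> [/\ p \notin D, p != t & ~~ adj t p].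
Proof.
move=> tp px xS yS xy; split.
- by apply: contraL tp => pS; apply: edge_ngate xS pS _; rewrite adjC.
- by apply: contraTneq px => ->; apply: nadj_t.
- have yx : adj y x by rewrite adjC.
  by apply: contra (edge_ngate yS xS yx) => tp'; apply/gateP; exists p.
Qed.

(** Otherwise [u], [v], [z] form a cherry that pegs [w] and leaves [2 * alpha - 2] stuck pegs. This
    is equality in [stuck_bound], so they contain no triangle, and an independent half together with
    two further vertices exceeds [alpha]. *)
Lemma edge_private u v p z : u \in D -> v \in D -> adj u v -> gate t p ->
  adj p v -> z \in D -> adj p z -> z \in [:: u; v].
Proof.
move=> uD vD uv tp pv zD pz; apply: contraT => zuv.
have vu : adj v u by rewrite adjC.
have [pD pt ntp] := gate_out tp pv vD uD vu.
have /gateP[w tw wp] := tp; have wt : adj w t by rewrite adjC.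
have pw : adj p w by rewrite adjC.
pose S := D :\: [set s in [:: u; v; z]].
have wS : w \notin S by apply: contraL tw; rewrite inE => /andP[_ /nadj_t].
have SD : S \subset D by apply: subsetDl.
have cS : #|S| + 3 = 2 * alpha + 1.
  apply: (@card_rest [:: u; v; z]).
    move: zuv; rewrite /= !inE !negb_or (adj_neq uv) => /andP[zu zv].
    by rewrite eq_sym zu eq_sym zv.
  by move=> s; rewrite !inE => /or3P[] /eqP->.
have [nr|st] := boolP (near 3 S w).
  case/negP: (@unsol_leq 6 isT).
  apply: (@solvable_cherry G 4 D u v z p w t) => //; try by rewrite adjC.
  exact: solvable_guard.
have p4 := stuck_path4_free wS st.
have tf : triangle_free S.
  have [A [_ tf cA]] := stuck_bound wS st.
  have /eqP : #|A| = 0 by move: cA cS; clear; lia.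
  by rewrite cards_eq0 => /eqP A0; rewrite A0 setD0 in tf.
have [/existsP[s /andP[sS ps]]|none] := boolP [exists s, (s \in S) && adj p s].
  (* [s] is at distance 2 from [w], hence isolated in [S]. *)
  have iso r : r \in S -> ~~ adj s r.
    move=> rS; apply/negP=> sr; have rs : adj r s by rewrite adjC.
    by case/negP: (stuck_ngate st rS sS rs); apply/gateP; exists p.
  have sub : S :\ s \subset S by apply: subD1set.
  have [I [IS indI cI]] :=
    half_independent (path4_free_sub sub p4) (triangle_free_sub sub tf).
  have IS' r : r \in I -> r \in S by move/(subsetP IS); apply: subsetP.
  have sI : s \notin I by apply/negP=> /(subsetP IS); rewrite !inE eqxx.
  have wsI : w \notin s |: I.
    by apply: contra wS => /setU1P[->|/IS'].
  have ind : independent (w |: (s |: I)).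
    apply: independentU1; first by apply: independentU1 => // r /IS'/iso.
    by move=> r /setU1P[->|/IS' rS]; apply: stuck_nadj st _ _.
  have := indep_le ind; rewrite !cardsU1 wsI sI.
  by have := cardsD1 s S; rewrite sS; move: cI cS; clear; lia.
(* Here [p] has no neighbour in [S], so the two further vertices are [t] and [p]. *)
have [I [IS indI cI]] := half_independent p4 tf.
have ID r : r \in I -> r \in D by move/(subsetP IS); apply: subsetP.
have pI : p \notin I by apply: contra pD => /ID.
have tpI : t \notin p |: I.
  by rewrite !inE negb_or eq_sym pt; apply: contra t_notin => /ID.
have ind : independent (t |: (p |: I)).
  apply: independentU1.
    apply: independentU1 => // r /(subsetP IS) rS; apply: contra none => pr.
    by apply/existsP; exists r; rewrite rS.
  by move=> r /setU1P[->//|/ID]; apply: nadj_t.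
by have := indep_le ind; rewrite !cardsU1 tpI pI; move: cI cS; clear; lia.
Qed.

Definition private p v :=
  [/\ gate t p, adj p v, p \notin D, p != t /\ ~~ adj t p
    & forall z, z \in D -> adj p z -> z = v].

(** The two edges at [v] confine the pegged neighbours of [p] to [{u, v}] and to [{v, x}]. *)
Lemma gate_private u v x p : u \in D -> v \in D -> x \in D -> u != x ->
  adj u v -> adj v x -> gate t p -> adj p v -> private p v.
Proof.
move=> uD vD xD ux uv vx tp pv; have xv : adj x v by rewrite adjC.
have [pD pt ntp] := gate_out tp pv vD xD vx; split=> // z zD pz.
have := edge_private uD vD uv tp pv zD pz.
have := edge_private xD vD xv tp pv zD pz.
rewrite !inE => /orP[/eqP-> /orP[|/eqP//]|/eqP-> //].
by rewrite eq_sym (negPf ux).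
Qed.

(** Both [t] and [p] can be added to an independent set of pegs that misses [v]. *)
Lemma private_indep p v I : private p v -> I \subset D -> v \notin I ->
  independent I -> #|I| + 2 <= alpha.
Proof.
case=> _ pv pD [pt ntp] priv ID vI indI.
have pI : p \notin I by apply: contra pD => /(subsetP ID).
have tpI : t \notin p |: I.
  by rewrite !inE negb_or eq_sym pt; apply: contra t_notin => /(subsetP ID).
have ind : independent (t |: (p |: I)).
  apply: independentU1.
    apply: independentU1 => // r rI; apply: contra vI => pr.
    by rewrite -(priv r (subsetP ID _ rI) pr).
  by move=> r; rewrite !inE => /orP[/eqP->//|/(subsetP ID)]; apply: nadj_t.
by have := indep_le ind; rewrite !cardsU1 tpI pI; clear; lia.
Qed.

Lemma private2_indep p v q s I : private p v -> private q s -> s \in D ->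
  v != s ->
  ~~ adj p q -> I \subset D -> v \notin I -> s \notin I ->
  independent I -> #|I| + 3 <= alpha.
Proof.
case=> _ pv pD [pt ntp] privp [_ qs qD [qt ntq] privq] sD vs pq ID vI sI indI.
have pI : p \notin I by apply: contra pD => /(subsetP ID).
have qI : q \notin I by apply: contra qD => /(subsetP ID).
have npq : p != q.
  by apply: contraNneq vs => e; rewrite -(privp s sD) // e.
have qpI : q \notin p |: I by rewrite !inE negb_or eq_sym npq.
have tqpI : t \notin q |: (p |: I).
  rewrite !inE !negb_or eq_sym qt eq_sym pt.
  by apply: contra t_notin => /(subsetP ID).
have ind : independent (t |: (q |: (p |: I))).
  apply: independentU1.
    apply: independentU1.
      apply: independentU1 => // r rI; apply: contra vI => pr.
      by rewrite -(privp r (subsetP ID _ rI) pr).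
    move=> r; rewrite !inE => /orP[/eqP->|rI]; first by rewrite adjC.
    by apply: contra sI => qr; rewrite -(privq r (subsetP ID _ rI) qr).
  move=> r; rewrite !inE => /orP[/eqP->//|/orP[/eqP->//|/(subsetP ID)]].
  exact: nadj_t.
by have := indep_le ind; rewrite !cardsU1 tqpI qpI pI; clear; lia.
Qed.

(** Equivalently, the components of [S] are one triangle and stars with at least one edge. *)
Definition one_triangle S :=
  [/\ path4_free S, exists a b c, triangle S a b c,
      forall a b c x y z, triangle S a b c -> triangle S x y z ->
        x \in [:: a; b; c]
    & forall z, z \in S -> exists2 y, y \in S & adj z y].

(** Three moves to peg [w] and four from [solvable_guard] make up the seven allowed. *)
Lemma stuck_rest (s : seq G) w : adj t w ->
  (forall n, solvable n (w |: D :\: [set z in s]) t -> solvable n.+3 D t) ->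
  w \notin D :\: [set z in s] /\ ~~ near 3 (D :\: [set z in s]) w.
Proof.
move=> tw sol.
have wS : w \notin D :\: [set z in s].
  by apply: contraL tw; rewrite inE => /andP[_ /nadj_t].
split=> //; apply: contra unsol => nr; apply: sol; apply: solvable_guard => //.
by rewrite adjC.
Qed.

(** For the [2 * alpha - 3] remaining pegs, [stuck_bound] allows at most one traded vertex, whereas
    [private_indep] caps independent subsets at [alpha - 2] and so forces at least one. *)
Lemma rest_one_triangle (s : seq G) w p v : uniq s -> size s = 4 ->
  {subset s <= D} -> private p v -> v \in s -> adj t w ->
  (forall n, solvable n (w |: D :\: [set z in s]) t -> solvable n.+3 D t) ->
  one_triangle (D :\: [set z in s]).
Proof.
move=> U s4 sD priv vs tw sol; have [wS st] := stuck_rest tw sol.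
have := card_rest U sD; rewrite s4.
move: (subsetDl D [set z in s]) wS st.
have : v \notin D :\: [set z in s] by rewrite !inE vs.
move: (D :\: [set z in s]) => S vS SD wS st cS.
have indS I : I \subset S -> independent I -> #|I| + 2 <= alpha.
  move=> IS; apply: (private_indep priv); first exact: subset_trans IS SD.
  by apply: contra vS => /(subsetP IS).
have p4 := stuck_path4_free wS st.
have [A [AS tf cA]] := stuck_bound wS st.
have halfS S' : S' \subset S -> triangle_free S' ->
    exists I, [/\ I \subset S', independent I & #|S'| <= 2 * #|I|].
  by move=> sub tf'; apply: half_independent tf'; apply: path4_free_sub sub p4.
have T0 : exists a b c, triangle S a b c.
  have [tfS|//] := triangle_dec S.
  have [I [IS indI cI]] := halfS S (subxx _) tfS.
  by have := indS I IS indI; move: cI cS cA; clear; lia.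
have cSA := cardsID A S; rewrite (setIidPr AS) in cSA.
have [a0 A1] : exists a0, A = [set a0].
  have [I [IS indI cI]] := halfS _ (subsetDl S A) tf.
  have := indS I (subset_trans IS (subsetDl S A)) indI => cI'.
  by apply/cards1P/eqP; move: cI cI' cS cA cSA; clear; lia.
subst A.
have a0T a b c : triangle S a b c -> a0 \in [:: a; b; c].
  move=> T; apply: contraT; rewrite !inE !negb_or => /and3P[na nb nc].
  case: (tf a b c); case: T => aS bS cS' adjs; split=> //;
    by rewrite !inE eq_sym ?na ?nb ?nc.
split=> //.
  move=> a b c x y z T1 T2; have a01 := a0T _ _ _ T1; have a02 := a0T _ _ _ T2.
  have [->//|xa] := eqVneq x a0.
  apply: (triangle_closed p4 T1 a01); first by case: T2.
  by apply: (triangle_adj T2) => //; rewrite ?inE ?eqxx // eq_sym.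
move=> z zS; apply/exists_inP; apply: contraT; rewrite negb_exists_in.
move/forall_inP=> iso.
have za : z != a0.
  case: T0 => a [b [c T]]; apply: contraTneq (a0T _ _ _ T) => <-.
  have [aS bS cS' [ab bc ac]] := T.
  rewrite !inE !negb_or; apply/and3P; split.
  + by apply: contraTneq ab => <-; apply: iso.
  + by apply: contraTneq bc => <-; apply: iso.
  + by rewrite adjC in ac; apply: contraTneq ac => <-; apply: iso.
(* An isolated [z], added to half of the [2 * alpha - 5] vertices other than [a0] and [z], would
   give [alpha - 1] independent pegs. *)
have sub : (S :\: [set a0]) :\ z \subset S.
  by apply: subset_trans (subD1set _ _) (subsetDl _ _).
have [I [IS indI cI]] := halfS _ sub (triangle_free_sub (subD1set _ _) tf).
have zI : z \notin I by apply/negP=> /(subsetP IS); rewrite !inE eqxx.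
have ISS := subset_trans IS sub.
have IS' : z |: I \subset S by rewrite subUset sub1set zS.
have ind : independent (z |: I).
  by apply: independentU1 => // y yI; apply: iso; apply: (subsetP ISS).
have := indS _ IS' ind; rewrite cardsU1 zI.
have := cardsD1 z (S :\: [set a0]); rewrite !inE za zS /= => cz.
by move: cz cI cS cA cSA; clear; rewrite cards1; lia.
Qed.

Lemma path4_one_triangle x y z s p : x \in D -> y \in D -> z \in D -> s \in D ->
  uniq [:: x; y; z; s] -> adj x y -> adj y z -> adj z s ->
  gate t p -> adj p y ->
  one_triangle (D :\: [set r in [:: x; y; z; s]]) /\
  forall w, adj t w -> adj w p -> ~~ near 3 (D :\: [set r in [:: x; y; z; s]]) w.
Proof.
move=> xD yD zD sD U xy yz zs tp py.
have xz : x != z by move: U; rewrite /= !inE !negb_or => /and3P[/and3P[]].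
have priv := gate_private xD yD zD xz xy yz tp py.
have [_ _ pD _ _] := priv.
have sol w : adj t w -> adj w p -> forall n,
    solvable n (w |: D :\: [set r in [:: x; y; z; s]]) t -> solvable n.+3 D t.
  move=> tw wp n; apply: (solvable_path4 xD yD zD sD U xy yz zs _ _ pD);
    by rewrite adjC.
split; last by move=> w tw wp; case: (stuck_rest tw (sol w tw wp)).
have /gateP[w tw wp] := tp.
apply: (rest_one_triangle U _ _ priv _ tw (sol w tw wp)) => //.
  by move=> r; rewrite !inE => /or4P[] /eqP->.
by rewrite !inE eqxx orbT.
Qed.

Lemma two_edges_one_triangle x y z s p q : x \in D -> y \in D -> z \in D ->
  s \in D -> uniq [:: x; y; z; s] -> adj x y -> adj z s ->
  private p x -> gate t q -> adj q z -> adj p q ->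
  one_triangle (D :\: [set r in [:: x; y; z; s]]).
Proof.
move=> xD yD zD sD U xy zs privp tq qz pq.
have [_ px pD _ _] := privp; have [qD _ _] := gate_out tq qz zD sD zs.
have /gateP[w tw wq] := tq.
apply: (rest_one_triangle U _ _ privp _ tw) => //.
- by move=> r; rewrite !inE => /or4P[] /eqP->.
- by rewrite !inE eqxx.
- move=> n; apply: (solvable_two_edges xD yD zD sD U xy zs _ _ pq _ pD qD);
    by rewrite adjC.
Qed.

(** Were [D] free of paths on four vertices, [trade_bound] with [t] in the role of [w] would
    contradict [cardD]. *)
Lemma ex_path4 : exists x y z s p,
  [/\ x \in D, y \in D, z \in D & s \in D] /\
  [/\ uniq [:: x; y; z; s], adj x y, adj y z & adj z s] /\ gate t p /\ adj p y.
Proof.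
pose path4 x y z s := [&& x \in D, y \in D, z \in D, s \in D &
  [&& uniq [:: x; y; z; s], adj x y, adj y z & adj z s]].
case: (boolP [exists x, exists y, exists z, exists s, path4 x y z s]).
  case/existsP=> x /existsP[y /existsP[z /existsP[s]]].
  case/and5P=> xD yD zD sD /and4P[U xy yz zs].
  have [p tp [py|pz]] := edge_gate yD zD yz; first by exists x, y, z, s, p.
  exists s, z, y, x, p; split=> //; split=> //; split=> //; try by rewrite adjC.
  by rewrite -[_ :: _]/(rev [:: x; y; z; s]) rev_uniq.
move=> no4; have p4 : path4_free D.
  move=> x y z s xD yD zD sD U xy yz zs; case/negP: no4.
  apply/existsP; exists x; apply/existsP; exists y; apply/existsP; exists z.
  by apply/existsP; exists s; rewrite /path4 xD yD zD sD U xy yz zs.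
have priv a b c p : triangle D a b c -> gate t p -> adj p a -> private p a.
  case=> aD bD cD [ab bc ac]; apply: (gate_private bD aD cD) => //.
    exact: adj_neq.
  by rewrite adjC.
have [] := trade_bound t_notin nadj_t p4 edge_gate gate_out.
- by move=> a b c p z T tp pa; have [_ _ _ _] := priv a b c p T tp pa; apply.
- move=> a b c a' b' p p' T a'D b'D a'b' U ca cb tp pa tp' p'a'.
  have [aD bD cD [ab bc ac]] := T; apply/negP=> pp'.
  have [_ _ _ niso] := two_edges_one_triangle aD bD a'D b'D U ab a'b'
    (priv _ _ _ _ T tp pa) tp' p'a' pp'.
  (* Spending [a] and [b] takes away both neighbours of [c], which [one_triangle] forbids. *)
  have cS : c \in D :\: [set r in [:: a; b; a'; b']].
    rewrite !inE !negb_or ca cb cD eq_sym (adj_neq ac) eq_sym.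
    by rewrite (adj_neq bc).
  have [y + cy] := niso c cS; rewrite !inE !negb_or.
  case/andP=> /and4P[ya yb _ _] yD.
  have : y \in [:: a; b; c].
    by apply: (triangle_closed p4 T (x := c)); rewrite // !inE eqxx !orbT.
  by rewrite !inE (negPf ya) (negPf yb) eq_sym (negPf (adj_neq cy)).
- by move=> A [_ _]; rewrite cardD; clear; lia.
Qed.

(* The triangle of [S'] must use [e] or [f], so it consists of [e], [f] and
   the vertex [q], which has no neighbour left in [S]. *)
Lemma triangle_attach S S' a b q e f :
  one_triangle S -> triangle S a b q -> one_triangle S' ->
  (forall z, z \in S' -> z \in [:: e; f] \/ z \in S /\ z \notin [:: a; b]) ->
  e \in S' -> f \in S' -> q \in S' -> q \notin [:: e; f] -> adj e f ->
  adj q e /\ adj q f.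
Proof.
move=> [p4 _ uni _] T [p4' [x [y [z T']]] _ niso] cases eS fS qS qef ef.
have eT_or_fT : (e \in [:: x; y; z]) || (f \in [:: x; y; z]).
  apply: contraT; rewrite negb_or => /andP[eT fT].
  have inS r : r \in S' -> r \in [:: x; y; z] -> r \in S /\ r \notin [:: a; b].
    move=> rS rT; have [ref|//] := cases r rS.
    by move: ref eT fT; rewrite !inE => /orP[] /eqP <-; move: rT; rewrite !inE => ->.
  have [xS yS zS xyz] := T'.
  have [xS1 xab] := inS x xS (mem_head _ _).
  have [yS1 yab] : y \in S /\ y \notin [:: a; b] by apply: inS; rewrite // !inE eqxx orbT.
  have [zS1 _] : z \in S /\ z \notin [:: a; b] by apply: inS; rewrite // !inE eqxx !orbT.
  have T1 : triangle S x y z by [].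
  have := uni _ _ _ _ _ _ T T1; have := uni _ _ _ _ _ _ T (triangle_rot T1).
  move: xab yab; rewrite !inE !negb_or => /andP[/negPf-> /negPf->].
  case/andP=> /negPf-> /negPf-> /= /eqP yq /eqP xq.
  by case: xyz; rewrite xq yq adj_irr.
have fe : adj f e by rewrite adjC.
have efT : e \in [:: x; y; z] /\ f \in [:: x; y; z].
  by case/orP: eT_or_fT => rT; split=> //; apply: (triangle_closed p4' T' rT).
have qT : q \in [:: x; y; z].
  have [r rS qr] := niso q qS; have rq : adj r q by rewrite adjC.
  have [ref|[rS1 rab]] := cases r rS.
    apply: (triangle_closed p4' T' _ qS rq).
    by case: efT; move: ref; rewrite inE => /predU1P[->|/[!inE]/eqP->].
  have : r \in [:: a; b; q].
    by apply: (triangle_closed p4 T _ rS1 qr); rewrite !inE eqxx !orbT.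
  move: rab; rewrite !inE !negb_or => /andP[/negPf-> /negPf->] /=.
  by rewrite (negPf (adj_neq rq)).
case: efT => eT fT.
move: qef; rewrite !inE negb_or => /andP[qe qf].
by split; apply: (triangle_adj T').
Qed.

Lemma unsolvable_absurd : False.
Proof.
have [u [v [x [y [p [[uD vD xD yD] [[U uv vx xy] [tp pv]]]]]]]] := ex_path4.
have [oneS stS] := path4_one_triangle uD vD xD yD U uv vx xy tp pv.
have ux : u != x by move: U; rewrite /= !inE !negb_or => /and3P[/and3P[]].
have privp := gate_private uD vD xD ux uv vx tp pv.
have inS z : z \in D :\: [set r in [:: u; v; x; y]] ->
    z \in D /\ [/\ z != u, z != v, z != x & z != y].
  by rewrite !inE !negb_or => /andP[/and4P[]].
have SI z : z \in D -> [&& z != u, z != v, z != x & z != y] ->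
    z \in D :\: [set r in [:: u; v; x; y]].
  by rewrite !inE !negb_or => -> ->.
have SD := subsetDl D [set r in [:: u; v; x; y]].
have cS : #|D :\: [set r in [:: u; v; x; y]]| + 4 = 2 * alpha + 1.
  by apply: (card_rest U) => r; rewrite !inE => /or4P[] /eqP->.
move: (D :\: [set r in [:: u; v; x; y]]) => S in oneS stS inS SI SD cS.
have [p4 [a0 [b0 [c0 T0]]] uni _] := oneS.
have [uv' [ux' [uy [vx' [vy xy']]]]] : u != v /\ u != x /\ u != y /\ v != x /\
    v != y /\ x != y.
  by move: U; rewrite /= !inE !negb_or => /and4P[/and3P[-> -> ->] /andP[-> ->] ->].
have vu : adj v u by rewrite adjC.
(* Spending [s], [r], [v], [u] instead of the path frees [x] and [y]; comparing the two remainders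
   attaches [q] to both. *)
have attach_xy s r q : triangle S s r q ->
    (exists2 ps, gate t ps & adj ps s) -> adj q x /\ adj q y.
  move=> T [ps tps pss]; have [sS rS qS [sr rq sq]] := T.
  have [sD [su sv sx sy]] := inS s sS; have [rD [ru rv rx ry]] := inS r rS.
  have [qD [qu qv qx qy]] := inS q qS.
  have rs : adj r s by rewrite adjC.
  have privs := gate_private rD sD qD (adj_neq rq) rs sq tps pss.
  (* If not adjacent, [ps] and [p] could be added with [t] to half of [S :\ s], giving more than
     [alpha] vertices. *)
  have [psp|npsp] := boolP (adj ps p); last first.
    have sub : S :\ s \subset S by apply: subD1set.
    have tf : triangle_free (S :\ s).
      move=> d e f T1; have := uni _ _ _ _ _ _ (triangle_sub sub T1) T.
      case: T1 => dS eS fS _; rewrite !inE.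
      by case/or3P=> /eqP se; move: dS eS fS; rewrite -se !inE eqxx.
    have [I [IS indI cI]] := half_independent (path4_free_sub sub p4) tf.
    have ISS := subset_trans IS sub.
    have sI : s \notin I by apply/negP=> /(subsetP IS); rewrite !inE eqxx.
    have vI : v \notin I.
      by apply/negP=> /(subsetP ISS)/inS[_ []]; rewrite eqxx.
    have := private2_indep privs privp vD sv npsp (subset_trans ISS SD) sI vI indI.
    have := cardsD1 s S; rewrite sS; move: cI cS; clear; lia.
  have U' : uniq [:: s; r; v; u].
    by rewrite /= !inE !negb_or (adj_neq sr) su sv ru rv eq_sym uv'.
  have one' := two_edges_one_triangle sD rD vD uD U' sr vu privs tp pv psp.
  apply: (triangle_attach oneS T one') => //.
  - move=> z; rewrite !inE !negb_or => /andP[/and4P[zs zr zv zu] zD].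
    have [->|zx] := eqVneq z x; first by left.
    have [->|zy] := eqVneq z y; first by left.
    by right; rewrite (negPf zs) (negPf zr); split=> //; apply: SI; rewrite ?zu ?zv ?zx.
  - rewrite !inE !negb_or xD !(eq_sym x) sx rx ux' vx'; exact: isT.
  - rewrite !inE !negb_or yD !(eq_sym y) sy ry vy uy; exact: isT.
  - by rewrite !inE !negb_or qD qu qv eq_sym (adj_neq sq) eq_sym (adj_neq rq).
  - by rewrite !inE negb_or qx qy.
(* Spending the path [x], [s], [r], [y] frees [u] and [v] in the same way. *)
have attach_v s r q : triangle S s r q ->
    (exists2 ps, gate t ps & adj ps s) -> adj s x -> adj r y -> adj q v.
  move=> T [ps tps pss] sx' ry'; have [sS rS qS [sr rq sq]] := T.
  have [sD [su sv sx sy]] := inS s sS; have [rD [ru rv rx ry]] := inS r rS.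
  have [qD [qu qv qx qy]] := inS q qS.
  have xs : adj x s by rewrite adjC.
  have U' : uniq [:: x; s; r; y].
    by rewrite /= !inE !negb_or (adj_neq sr) sy ry !(eq_sym x) sx rx eq_sym xy'.
  have [one' _] := path4_one_triangle xD sD rD yD U' xs sr ry' tps pss.
  apply: (proj2 (triangle_attach oneS T one' (e := u) (f := v) _ _ _ _ _ _)) => //.
  - move=> z; rewrite !inE !negb_or => /andP[/and4P[zx zs zr zy] zD].
    have [->|zu] := eqVneq z u; first by left.
    have [->|zv] := eqVneq z v; first by left; rewrite orbT.
    by right; rewrite (negPf zs) (negPf zr); split=> //; apply: SI; rewrite ?zu ?zv ?zx.
  - by rewrite !inE !negb_or uD ux' uy eq_sym su eq_sym ru.
  - by rewrite !inE !negb_or vD vx' vy eq_sym sv eq_sym rv.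
  - by rewrite !inE !negb_or qD qx qy eq_sym (adj_neq sq) eq_sym (adj_neq rq).
  - by rewrite !inE negb_or qu qv.
(* By [edge_gate] every edge of the triangle has an end with such a [q], so at least two of its
   vertices do. *)
have [a [b [c [T ga gb]]]] : exists a b c, [/\ triangle S a b c,
    exists2 q, gate t q & adj q a & exists2 q, gate t q & adj q b].
  have gen d e f : triangle S d e f -> (exists2 q, gate t q & adj q d) ->
      exists a b c, [/\ triangle S a b c, exists2 q, gate t q & adj q a
                      & exists2 q, gate t q & adj q b].
    move=> T gd; have [_ /inS[eD _] /inS[fD _] [_ ef _]] := T.
    have [q tq [qe|qf]] := edge_gate eD fD ef.
      by exists d, e, f; split=> //; exists q.
    by exists d, f, e; split; [apply: triangle_flip| |exists q].
  have [/inS[aD _] /inS[bD _] _ [ab _ _]] := T0.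
  have [q tq [qa|qb]] := edge_gate aD bD ab.
    by apply: gen T0 _; exists q.
  by apply: (gen b0 c0 a0); [apply: triangle_rot|exists q].
have T2 := triangle_flip T.
have [cx cy] := attach_xy _ _ _ T ga; have [bx by'] := attach_xy _ _ _ T2 ga.
have [ax ay] := attach_xy _ _ _ (triangle_rot T) gb.
have cv := attach_v _ _ _ T ga ax by'; have bv := attach_v _ _ _ T2 ga ax cy.
have /gateP[w tw wp] := tp; case/negP: (stS w tw wp).
have [aS bS cS' [ab bc ac]] := T.
have vS : v \notin S by apply/negP=> /inS[_ []]; rewrite eqxx.
apply: (near_leq (k := 2)) => //.
(* The vertex [v] was vacated with the path: [a] jumps over [b] into [v], then [c] over [v] into
   [p], next to [w]. *)
apply: (@near_cherry G S w a b c v p) => //; try by rewrite adjC.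
by rewrite !inE negb_or eq_sym (adj_neq ac) eq_sym (adj_neq bc).
Qed.

End Unsolvable.
End UpperBound.

(** * From weak moves to the pegging number *)

Lemma sub_card_exists (T : finType) (D : {set T}) n : n <= #|D| ->
  exists2 E : {set T}, E \subset D & #|E| = n.
Proof.
move=> nD; exists [set x in take n (enum D)].
  by apply/subsetP=> x; rewrite inE => /mem_take; rewrite mem_enum.
rewrite cardsE; have /card_uniqP -> := take_uniq n (enum_uniq D).
by rewrite size_take -cardE; case: ltngtP nD.
Qed.

Section ConcludeUpper.
Variable G : sgraph.
Implicit Types (x y u v t : G) (D : {set G}).

Lemma walk_le3 j x y : walk j x y -> j <= 3 ->
  [\/ x = y, adj x y, gate x y | exists2 p, gate x p & adj p y].
Proof.
case=> [[|a [|b [|c [|d s]]]]] [/= + <- <-] //; rewrite ?andbT => H _.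
- by constructor 1.
- by constructor 2.
- by case/andP: H => xa ab; constructor 3; apply/gateP; exists a.
- by case/and3P: H => xa ab bc; constructor 4; exists b => //; apply/gateP; exists a.
Qed.

Lemma ve_diameter3_edge : ve_diameter G 3 ->
  forall x u v, adj u v -> exists2 y, y \in [:: u; v] &
    [\/ x = y, adj x y, gate x y | exists2 p, gate x p & adj p y].
Proof.
case=> _ H x u v uv; have [j [d _] j3] := H x u v uv.
by case: d => [[wk _]|[wk _]]; [exists u|exists v];
  rewrite ?inE ?eqxx ?orbT //; apply: walk_le3 wk j3.
Qed.

Lemma reachable_within7 : ve_diameter G 3 -> forall D t,
  2 * independence_number G + 1 <= #|D| -> reachable_within 7 D t.
Proof.
move=> ve D t /sub_card_exists[E ED cE]; apply: solvable_reachable_within.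
apply: solvable_sub ED _; apply: contraT => unsol.
case: (unsolvable_absurd (ve_diameter3_edge ve) _ cE unsol) => I indI.
by rewrite /independence_number (bigmax_sup I).
Qed.

Lemma pegging_number_le : ve_diameter G 3 ->
  pegging_number G <= 2 * independence_number G + 1.
Proof.
move=> ve; rewrite /pegging_number; case: ex_minnP => d _; apply.
rewrite /pegging_bound addn1 /=; apply/forallP=> D; apply/implyP=> /eqP cD.
apply/eqP/setP=> t; rewrite in_setT; apply: (@reachable_within_reach _ 7).
by apply: reachable_within7; rewrite // cD addn1.
Qed.

Lemma reach_solvable D t : t \in reach D -> exists n, solvable n D t.
Proof.
rewrite inE => /existsP[D' /andP[/connectP[s ps ->]]] {D'}.
elim: s D ps => [|D1 s IHs] D /=; first by exists 0; rewrite solvable0.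
case/andP=> /existsP[u /existsP[v /existsP[w]]].
case/and5P=> uD vD uv wD /andP[vw /eqP->] ps /(IHs _ ps)[n sol].
exists n.+1; apply: (@solvable_move _ u v w) => //.
by apply: solvable_sub sol; apply/subsetP=> z; rewrite !inE.
Qed.

(** A bound [d] tests only distributions of exactly [d] pegs; as [solvable] is monotone, a subset of
    [D] of that size would pass its reach on to [D]. *)
Lemma pegging_number_gt D t : t \notin reach D -> #|D| < pegging_number G.
Proof.
move=> tD; rewrite /pegging_number; case: ex_minnP => d /andP[_ /forallP all_d] _.
rewrite ltnNge; apply: contra tD => /sub_card_exists[E ED cE].
have := all_d E; rewrite cE eqxx /= => /eqP rE.
have [n sol] : exists n, solvable n E t by apply: reach_solvable; rewrite rE in_setT.
apply: (@reachable_within_reach _ n); apply: solvable_reachable_within.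
exact: solvable_sub ED sol.
Qed.

End ConcludeUpper.

(** * The extremal graph *)

Section Distances.
Variable G : sgraph.
Implicit Types (x y u v : G).

(** Makes [walk] decidable, so that [ex_minn] can extract a shortest length. *)
Lemma walkP k x y : reflect (walk k x y)
  [exists p : k.-tuple G, path (@adj G) x p && (last x p == y)].
Proof.
apply: (iffP existsP) => [[p /andP[xp /eqP e]]|[p [xp e /eqP sp]]].
  by exists p; rewrite size_tuple.
by exists (Tuple sp); rewrite xp e eqxx.
Qed.

Lemma walk_is_dist k x y : walk k x y -> exists2 j, is_dist x y j & j <= k.
Proof.
move=> /walkP wk.
have ex : exists j, [exists p : j.-tuple G, path (@adj G) x p && (last x p == y)].
  by exists k.
case: (ex_minnP ex) => j /walkP wj minj; exists j; last exact: minj.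
by split=> // i /walkP; apply: minj.
Qed.

Lemma is_dist_inj x y j k : is_dist x y j -> is_dist x y k -> j = k.
Proof. by case=> wj mj [wk mk]; apply/eqP; rewrite eqn_leq mj ?mk. Qed.

Lemma is_dist_edge_min x u v j k : is_dist x u j -> is_dist x v k ->
  is_dist_edge x u v (minn j k).
Proof.
move=> du dv; split.
  by rewrite /minn; case: ifP => _; [left|right].
by move=> i [/(is_dist_inj du)<-|/(is_dist_inj dv)<-]; rewrite geq_min leqnn ?orbT.
Qed.

Lemma walk_lipschitz (f : G -> nat) k x y :
  (forall u v, adj u v -> f v <= (f u).+1) -> walk k x y -> f y <= f x + k.
Proof.
move=> lip [p [xp <- <-]]; elim: p x xp => [|z p IHp] x /=; first by rewrite addn0.
by case/andP=> /lip fz /IHp; lia.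
Qed.

End Distances.

(** * Linked cliques: distances and independence *)

Section LinkedCliques.
Variable k : nat.
Notation index := 'I_k.+2.

(** [(i, inl j)] is the end in clique [i] of its link to clique [j], and [(i, inr l)] lies off the
    links, as does [(i, inl i)]. *)
Definition linked_vertex : finType := (index * (index + 'I_4))%type.
Implicit Types (x y z u v w : linked_vertex) (i j : index) (D : {set linked_vertex}).

Definition linked_adj : rel linked_vertex := fun x y =>
  if x.1 == y.1 then x.2 != y.2 else (x.2 == inl y.1) && (y.2 == inl x.1).

Lemma linked_sym : symmetric linked_adj.
Proof.
by move=> x y; rewrite /linked_adj eq_sym; case: ifP => _; rewrite 1?eq_sym // andbC.
Qed.

Lemma linked_irr : irreflexive linked_adj.
Proof. by move=> x; rewrite /linked_adj !eqxx. Qed.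

Definition linked : sgraph := SGraph linked_sym linked_irr.

Definition target : linked := (ord0, inr ord0).
Definition far_vertex : linked := (inord 1, inr ord0).
Definition far_vertex' : linked := (inord 1, inr (inord 1)).

(** A lower bound for the distance from [target], exact on the vertices of level 3. *)
Definition level (x : linked) : nat :=
  match x.2 with
  | inl j => if x.1 == ord0 then 1 else if j == ord0 then 2 else 3
  | inr _ => if x.1 == ord0 then 0 else 3
  end.

Lemma level_lip (x y : linked) : adj x y -> level y <= (level x).+1.
Proof.
case: x y => i a [j b]; rewrite /adj /= /linked_adj /level /=.
case: (eqVneq i j) => [->|ij].
  by case: a b => [a|a] [b|b] _; do ?case: ifP.
by case/andP=> /eqP-> /eqP->; case: (i == ord0); case: (j == ord0).
Qed.

Lemma far_neq0 : (inord 1 : index) != ord0.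
Proof. by rewrite -val_eqE /= inordK. Qed.

Lemma walk_short (x y : linked) : exists2 j, walk j x y & j <= 3.
Proof.
case: x y => i a [j b].
have in_clique (h : index) c d : exists2 l, walk l ((h, c) : linked) (h, d) & l <= 1.
  case: (eqVneq c d) => [->|cd]; first by exists 0 => //; exists [::].
  exists 1 => //; exists [:: ((h, d) : linked)]; split=> //=.
  by rewrite /adj /= /linked_adj /= eqxx cd.
case: (eqVneq i j) => [<-|ij].
  by have [l wl l1] := in_clique i a b; exists l => //; apply: leq_trans l1 _.
have [l1 [p1 [w1 e1 s1]] b1] := in_clique i a (inl j).
have [l2 [p2 [w2 e2 s2]] b2] := in_clique j (inl i) b.
exists (l1 + l2.+1); last lia.
exists (p1 ++ ((j, inl i) : linked) :: p2); split.
- rewrite cat_path w1 e1 /= w2 andbT /adj /= /linked_adj /= (negPf ij).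
  by rewrite !eqxx.
- by rewrite last_cat /= e2.
- by rewrite size_cat /= s1 s2.
Qed.

Lemma ex_dist (x y : linked) : exists2 j, is_dist x y j & j <= 3.
Proof.
have [j wj j3] := walk_short x y; have [i di ij] := walk_is_dist wj.
by exists i => //; apply: leq_trans ij j3.
Qed.

Lemma level_dist (y : linked) : level y = 3 -> is_dist target y 3.
Proof.
move=> ly; have [j dj j3] := ex_dist target y.
suff -> : 3 = j by [].
have := walk_lipschitz level_lip (proj1 dj); rewrite ly.
by rewrite /level /= add0n => j3'; apply/eqP; rewrite eqn_leq j3' j3.
Qed.

Lemma linked_diameter : diameter linked 3.
Proof.
split; last exact: ex_dist.
by exists target, far_vertex; apply: level_dist; rewrite /level /= (negPf far_neq0).
Qed.

Lemma linked_ve_diameter : ve_diameter linked 3.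
Proof.
split.
  exists target, far_vertex, far_vertex'; split.
    rewrite /adj /= /linked_adj /= eqxx; apply/eqP=> -[] /(congr1 val) /=.
    by rewrite inordK.
  have d1 : is_dist target far_vertex 3.
    by apply: level_dist; rewrite /level /= (negPf far_neq0).
  have d2 : is_dist target far_vertex' 3.
    by apply: level_dist; rewrite /level /= (negPf far_neq0).
  exact: is_dist_edge_min d1 d2.
move=> x u v _; have [j du j3] := ex_dist x u; have [l dv _] := ex_dist x v.
by exists (minn j l); [apply: is_dist_edge_min|rewrite geq_min j3].
Qed.

(** A clique contributes at most one vertex, and the vertices [inr ord0] are pairwise unlinked. *)
Lemma linked_independence : independence_number linked = k.+2.
Proof.
apply/eqP; rewrite eqn_leq; apply/andP; split.
  apply/bigmax_leqP=> I /independentP indI.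
  have inj : {in I &, injective (fun x : linked => x.1)}.
    move=> x y xI yI xy; apply/eqP; have := indI x y xI yI.
    rewrite /adj /= /linked_adj xy eqxx negbK => /eqP xy2.
    by rewrite [x]surjective_pairing xy xy2 -surjective_pairing.
  rewrite -(card_in_imset inj) -[X in _ <= X]card_ord.
  exact: max_card.
pose I := [set (i, inr ord0) | i : index] : {set linked}.
have cI : #|I| = k.+2.
  by rewrite card_imset ?card_ord // => i j [].
rewrite -cI (bigmax_sup I) //; apply/independentP=> x y /imsetP[i _ ->] /imsetP[j _ ->].
by rewrite /adj /= /linked_adj /=; case: (i == j).
Qed.

(** * The invariant of the extremal distribution *)

Definition weight x : nat := if x.2 is inl _ then 2 else 1.
(** With link ends counting double, sending a peg to another clique costs at least three units of
    load and delivers at most two. *)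
Definition load D i := \sum_(x in D) (x.1 == i) * weight x.

Lemma load_move D u v w i : u \in D -> v \in D -> u != v -> w \notin D ->
  load (w |: D :\: [set u; v]) i +
    ((u.1 == i) * weight u + (v.1 == i) * weight v) =
  load D i + (w.1 == i) * weight w.
Proof.
move=> uD vD uv wD; rewrite /load.
rewrite big_setU1 /=; last by rewrite !inE (negPf wD) andbF.
rewrite [in RHS](big_setD1 u) //= [in RHS](big_setD1 v) /=; last first.
  by rewrite in_setD1 eq_sym uv.
have -> : (D :\ u) :\ v = D :\: [set u; v].
  by apply/setP=> z; rewrite !inE negb_or andbA; congr (_ && _); rewrite andbC.
lia.
Qed.

Lemma load_mem D u : u \in D -> weight u <= load D u.1.
Proof.
by move=> uD; rewrite /load (big_setD1 u) //= eqxx mul1n leq_addr.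
Qed.

Lemma load_mem2 D u v : u \in D -> v \in D -> u != v -> u.1 = v.1 ->
  weight u + weight v <= load D u.1.
Proof.
move=> uD vD uv e; rewrite /load (big_setD1 u) //= eqxx mul1n leq_add2l.
rewrite (big_setD1 v) /=; last by rewrite in_setD1 eq_sym uv.
by rewrite e eqxx mul1n leq_addr.
Qed.

Lemma weight_le2 x : weight x <= 2.
Proof. by rewrite /weight; case: x.2. Qed.

Lemma weight_gt0 x : 0 < weight x.
Proof. by rewrite /weight; case: x.2. Qed.

Lemma linked_cross x y : linked_adj x y -> x.1 != y.1 ->
  x = (x.1, inl y.1) /\ y = (y.1, inl x.1).
Proof.
case: x y => i a [j b]; rewrite /linked_adj /= => + ij.
by rewrite (negPf ij) => /andP[/eqP-> /eqP->].
Qed.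

(* The clique of the target is empty, and at most one clique can send a peg
   to another one. *)
Definition before_entry D :=
  (forall x, x \in D -> x.1 != ord0) /\
  exists i0, load D i0 <= 4 /\ forall j, j != i0 -> load D j <= 2.

(* The only peg in the clique of the target sits at the end of the link to
   clique [i], where no peg can get to the other end of that link. *)
Definition after_entry D := exists i, [/\ i != ord0,
  forall x, x \in D -> x.1 = ord0 -> x = (ord0, inl i),
  load D i <= 1 & forall j, j != ord0 -> load D j <= 2].

Definition harmless D := before_entry D \/ after_entry D.

Lemma target_harmless D : harmless D -> target \notin D.
Proof.
case=> [[notC0 _]|[i [_ inC0 _ _]]]; apply/negP.
  by move/notC0; rewrite eqxx.
by move/inC0=> /(_ erefl).
Qed.

(** A jump lands outside the clique of [v] only if [u] lies in that clique and [v] is a link end,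
    which takes load at least three there. No other move raises a load. *)
Lemma harmless_move D u v w : u \in D -> v \in D -> linked_adj u v ->
  w \notin D -> linked_adj v w -> harmless D ->
  harmless (w |: D :\: [set u; v]).
Proof.
move=> uD vD uv wD vw.
have nuv : u != v by apply: contraTneq uv => ->; rewrite linked_irr.
have L i := load_move i uD vD nuv wD.
have mem x : x \in w |: D :\: [set u; v] -> x = w \/ x \in D.
  by rewrite !inE => /orP[/eqP->|/andP[]]; [left|right].
have wu := weight_gt0 u; have wv := weight_gt0 v; have ww := weight_le2 w.
(* A peg jumping along a link cannot return to the clique it came from. *)
have stay : u.1 != v.1 -> w.1 = v.1.
  move=> cr; have [eu ev] := linked_cross uv cr; apply/eqP.
  apply: contraNT wD; rewrite eq_sym => cr'; have [ev' ew] := linked_cross vw cr'.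
  have ew1 : w.1 = u.1 by move: ev; rewrite {1}ev' => -[].
  by rewrite ew ew1 -eu.
have load_le : w.1 = v.1 -> forall i, load (w |: D :\: [set u; v]) i <= load D i.
  move=> wv1 i; have := L i; rewrite wv1.
  have [e|ne] := eqVneq v.1 i; last by move: wu wv ww; clear; lia.
  have [e'|cr] := eqVneq u.1 i; first by rewrite !mul1n; move: wu wv ww; clear; lia.
  (* A peg jumped over along a link has weight two, as much as any peg that lands. *)
  have [|_ ev] := linked_cross uv; first by rewrite e.
  have -> : weight v = 2 by rewrite ev.
  by rewrite !mul1n mul0n; move: wu ww; clear; lia.
case=> [[notC0 [i0 [le4 le2]]]|[i [i0 inC0 le1 le2]]].
  have [wv1|wv1] := eqVneq w.1 v.1.
    left; split.
      by move=> x /mem[->|/notC0//]; rewrite wv1; apply: notC0.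
    exists i0; split; first exact: leq_trans (load_le wv1 _) le4.
    by move=> j /le2; apply: leq_trans; apply: load_le.
  have uv1 : u.1 = v.1 by apply/eqP; apply: contraNT wv1 => /stay->.
  have vw1 : v.1 != w.1 by rewrite eq_sym.
  have [ev ew] := linked_cross vw vw1.
  have v2 : weight v = 2 by rewrite ev.
  have ld := load_mem2 uD vD nuv uv1.
  have ei0 : u.1 = i0.
    apply/eqP; apply: contraT => /le2; move: ld; rewrite v2; move: wu; clear; lia.
  have Lu : load (w |: D :\: [set u; v]) v.1 <= 1.
    have := L v.1; rewrite uv1 eqxx (negPf wv1) v2 !mul1n mul0n.
    by move: le4 wu; rewrite -ei0 uv1; clear; lia.
  have Lother j : j != v.1 -> j != w.1 -> load (w |: D :\: [set u; v]) j <= 2.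
    move=> jv jw; have := L j; rewrite uv1 (eq_sym v.1) (negPf jv) (eq_sym w.1) (negPf jw).
    by have := le2 j; rewrite -ei0 uv1 => /(_ jv); clear; lia.
  (* The sending clique keeps load at most one. If the peg does not enter the clique of [target],
     the receiving clique has load at most [2 + 2] and becomes the new [i0]. *)
  have [w0|w0] := eqVneq w.1 ord0.
    right; exists v.1; split=> //.
    - exact: notC0.
    - move=> x /mem[-> _|/notC0 + x0]; last by rewrite x0 eqxx.
      by rewrite ew w0.
    - move=> j j0; have [->|jv] := eqVneq j v.1; first exact: leq_trans Lu _.
      by apply: Lother; rewrite // w0.
  left; split.
    by move=> x /mem[->|/notC0].
  exists w.1; split.
    have := L w.1; rewrite uv1 (eq_sym v.1) (negPf wv1) eqxx mul1n !mul0n.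
    by have := le2 w.1; rewrite -ei0 uv1 => /(_ wv1); move: ww; clear; lia.
  move=> j jw; have [->|jv] := eqVneq j v.1; first exact: leq_trans Lu _.
  exact: Lother.
have no_link x : x \in D -> x.1 = i -> weight x <= 1.
  by move=> xD xi; apply: leq_trans (load_mem xD) _; rewrite xi.
(* Jumping over the single peg there needs a peg of weight two at the other end of its link, in
   clique [i] of load at most one. *)
have v0 : v.1 != ord0.
  apply/negP=> /eqP v0; have ev := inC0 v vD v0.
  have [u0|cr] := eqVneq u.1 v.1.
    by move: nuv; rewrite ev (inC0 u uD) ?eqxx // u0.
  have [eu ev'] := linked_cross uv cr.
  have ui : u.1 = i by move: ev; rewrite {1}ev' => -[].
  by have := no_link u uD ui; rewrite eu.
(* Leaving the clique of [v] takes load three, but it has at most two. *)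
have wv1 : w.1 = v.1.
  have [uv1|/stay//] := eqVneq u.1 v.1.
  apply/eqP; apply: contraT; rewrite eq_sym => vw1.
  have [ev _] := linked_cross vw vw1.
  have := load_mem2 uD vD nuv uv1; have := le2 v.1 v0; rewrite uv1.
  have -> : weight v = 2 by rewrite ev.
  by move: wu; clear; lia.
right; exists i; split=> //.
- by move=> x /mem[-> w0|]; [rewrite wv1 in w0; rewrite w0 eqxx in v0|apply: inC0].
- exact: leq_trans (load_le wv1 _) le1.
- by move=> j /le2; apply: leq_trans; apply: load_le.
Qed.

Definition hard : {set linked} := [set x : linked_vertex | (x.1 != ord0) &&
  (if x.2 is inr l then (x.1 == inord 1) || (l < 2) else false)].

Lemma sum_linked (F : linked -> nat) :
  \sum_(x in hard) F x =
  \sum_(i : index | i != ord0)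
    \sum_(l < 4 | (i == inord 1) || (l < 2)) F (i, inr l).
Proof.
transitivity (\sum_(i : index | i != ord0)
    \sum_(s : index + 'I_4 | (i, s) \in hard) F (i, s)).
  rewrite pair_big_dep /=; apply: eq_big => [[i s]|[i s] _] //=.
  by rewrite inE /=; case: (i != ord0).
apply: eq_bigr => i i0; rewrite big_sumType /= big1 ?add0n; last first.
  by move=> j; rewrite inE andbF.
by apply: eq_bigl => l; rewrite inE i0.
Qed.

Lemma sum_block (i : index) : \sum_(l < 4 | (i == inord 1) || (l < 2)) 1 =
  if i == inord 1 then 4 else 2.
Proof.
by rewrite big_mkcond !big_ord_recl big_ord0 /=; case: (i == inord 1).
Qed.

Lemma card_hard : #|hard| = 2 * k.+2.
Proof.
rewrite -sum1_card sum_linked (bigD1 (inord 1)) ?far_neq0 //= sum_block eqxx.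
rewrite (eq_bigr (fun=> 2)); last first.
  by move=> i /andP[_ i1]; rewrite sum_block (negPf i1).
rewrite sum_nat_const.
(* Two indices are excluded, so [k] cliques hold two pegs each: [4 + 2 * k] in all. *)
have := cardC [pred i : index | (i != ord0) && (i != inord 1)].
rewrite card_ord (_ : #|[predC _]| = 2); last first.
  rewrite -[RHS](_ : #|[set ord0; inord 1 : index]| = 2).
    by apply: eq_card => i; rewrite !inE negb_and !negbK.
  by rewrite cards2 eq_sym far_neq0.
have -> : #|[pred i : index | (i != ord0) && (i != inord 1)]| =
    #|(fun i : index => (i != ord0) && (i != inord 1))| by apply: eq_card.
lia.
Qed.

Lemma load_hard i : load hard i <= if i == inord 1 then 4 else 2.
Proof.
rewrite /load sum_linked /= -(sum_block i).
have [->|i0] := eqVneq i ord0.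
  rewrite big1 // => j /negPf j0; rewrite big1 // => l _.
  by rewrite j0.
rewrite (bigD1 i) //= [X in _ + X]big1 ?addn0.
  by apply: leq_sum => l _; rewrite eqxx.
by move=> j /andP[_ /negPf ji]; rewrite big1 // => l _; rewrite ji.
Qed.

Lemma hard_harmless : harmless hard.
Proof.
left; split; first by move=> x; rewrite inE => /andP[].
exists (inord 1); split; first by have := load_hard (inord 1); rewrite eqxx.
by move=> j /negPf j1; have := load_hard j; rewrite j1.
Qed.

Lemma target_unreachable : target \notin reach hard.
Proof.
rewrite inE; apply/negP=> /existsP[D' /andP[/connectP[s ps ->]]] {D'}; apply/negP.
apply: target_harmless; elim: s hard hard_harmless ps => //= D1 s IHs D hD.
case/andP=> /existsP[u /existsP[v /existsP[w]]].
case/and5P=> uD vD uv wD /andP[vw /eqP->]; apply: IHs; exact: harmless_move.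
Qed.

Lemma linked_pegging_number : pegging_number linked = 2 * k.+2 + 1.
Proof.
apply/eqP; rewrite eqn_leq; apply/andP; split.
  by rewrite -linked_independence; apply: pegging_number_le linked_ve_diameter.
by have := pegging_number_gt target_unreachable; rewrite card_hard addn1.
Qed.

End LinkedCliques.

Theorem theorem6p4 (alpha : nat) (alpha_ge2 : 2 <= alpha) :
  [/\ (forall G : sgraph,
         ve_diameter G 3 -> independence_number G = alpha ->
         pegging_number G <= 2 * alpha + 1),
      (exists G : sgraph,
         [/\ diameter G 3, ve_diameter G 3, independence_number G = alpha
           & pegging_number G = 2 * alpha + 1]),
      is_maximum
        (fun m => exists G : sgraph,
           [/\ ve_diameter G 3, independence_number G = alpha
             & pegging_number G = m])
        (2 * alpha + 1)
    & (forall G : sgraph,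
         ve_diameter G 3 -> independence_number G = alpha ->
         forall (D : {set G}) (t : G),
           2 * alpha + 1 <= #|D| -> reachable_within 7 D t)].
Proof.
(* Writing [alpha] as [k.+2] makes it the number of cliques of [linked k]. *)
case: alpha alpha_ge2 => [|[|k]] // _.
have sharp : [/\ diameter (linked k) 3, ve_diameter (linked k) 3,
    independence_number (linked k) = k.+2
    & pegging_number (linked k) = 2 * k.+2 + 1].
  split; [exact: linked_diameter|exact: linked_ve_diameter|
    exact: linked_independence|exact: linked_pegging_number].
split.
- by move=> G ve <-; apply: pegging_number_le.
- by exists (linked k).
- split; first by exists (linked k); case: sharp.
  by move=> m [G [ve <- <-]]; apply: pegging_number_le.
- by move=> G ve <-; apply: reachable_within7.
Qed.
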